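(* Let $p$ and $q$ be distinct odd primes and let $E_{p,q}$ be the elliptic curve $y^2=x^3-pqx$. Suppose that any one of the following conditions holds: (i) $p\equiv 1 \pmod 4$, $q\equiv 1\pmod 4$, $pq\equiv 13\pmod{16}$ and $\left(\frac{p}{q}\right)=-1$; (ii) $p\not\equiv q\pmod 4$, $pq\equiv 3\pmod 8$ and $\left(\frac{p}{q}\right)=-1$; (iii) $p\equiv q\equiv 3\pmod 4$, $\left(\frac{p}{q}\right)=1$, $q\equiv 3\pmod 8$, and $p-q\equiv 8$ or $12\pmod{16}$; (iv) $p\equiv q\equiv 3\pmod 4$, $\left(\frac{p}{q}\right)=-1$, $p\equiv 3\pmod 8$, and $q-p\equiv 8$ or $12\pmod{16}$. Then the rank of $E_{p,q}(\mathbb{Q}(i))$ is $0$.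
   Context: $\left(\frac{\cdot}{\cdot}\right)$ is the Legendre symbol, and $\mathbb{Q}(i)$ is the field obtained by adjoining $i=\sqrt{-1}$ to $\mathbb{Q}$. *)

(* Defs.v *)
From HB Require Import structures.
From mathcomp Require Import all_boot all_order all_algebra ring.
From mathcomp Require Export complex.

Set Implicit Arguments.
Unset Strict Implicit.
Unset Printing Implicit Defensive.

Import GRing.Theory Num.Theory.
Local Open Scope ring_scope.

(* y ^+ 2 = x ^+ 3 + a * x + b with nonzero discriminant; the factor 16
   excludes characteristic 2. *)
Record ellCurve (K : fieldType) := EllCurve {
  ellA : K;
  ellB : K;
  ell_disc_neq0 : - 16%:R * (4%:R * ellA ^+ 3 + 27%:R * ellB ^+ 2) != 0
}.

Section EllipticGroup.
Variables (K : fieldType) (E : ellCurve K).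

(* None is the point at infinity. *)
Definition on_curve (P : option (K * K)) : bool :=
  if P is Some (x, y) then y ^+ 2 == x ^+ 3 + ellA E * x + ellB E else true.

Record point := Point { point_val : option (K * K); _ : on_curve point_val }.

HB.instance Definition _ := [isSub for point_val].
HB.instance Definition _ := [Choice of point by <:].

Definition ell_opp (P : option (K * K)) : option (K * K) :=
  if P is Some (x, y) then Some (x, - y) else None.

Definition ell_slope (x1 y1 x2 y2 : K) : K :=
  if x1 == x2 then (3%:R * x1 ^+ 2 + ellA E) / (2%:R * y1)
  else (y2 - y1) / (x2 - x1).

Definition ell_add (P Q : option (K * K)) : option (K * K) :=
  match P, Q with
  | None, _ => Q
  | _, None => P
  | Some (x1, y1), Some (x2, y2) =>
    if (x1 == x2) && (y1 == - y2) then None else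
    let m := ell_slope x1 y1 x2 y2 in
    let x3 := m ^+ 2 - x1 - x2 in
    Some (x3, m * (x1 - x3) - y1)
  end.

Local Notation "P +' Q" := (ell_add P Q) (at level 50, left associativity).
Local Notation opp := ell_opp.
Local Notation on := on_curve.

Lemma ell_two_neq0 : 2%:R != 0 :> K.
Proof.
apply: contraNneq (ell_disc_neq0 E) => K2.
have e16 : 16%:R = 2%:R * 8%:R :> K by rewrite -natrM.
by rewrite e16 K2 mul0r oppr0 mul0r.
Qed.

Lemma ell_smooth (x y : K) :
  y ^+ 2 = x ^+ 3 + ellA E * x + ellB E -> y = 0 ->
  3%:R * x ^+ 2 + ellA E != 0.
Proof.
move=> H y0; apply: contraNneq (ell_disc_neq0 E) => d0.
have a_eq : ellA E = - (3%:R * x ^+ 2).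
  by apply/eqP; rewrite -addr_eq0 addrC d0.
have b_eq : ellB E = 2%:R * x ^+ 3.
  move: H; rewrite y0 expr0n /= a_eq => /esym/eqP.
  by rewrite addrC addr_eq0 => /eqP ->; ring.
by rewrite a_eq b_eq; apply/eqP; ring.
Qed.

Lemma ell_eq_opp (y : K) : (y == - y) = (y == 0).
Proof.
by rewrite -addr_eq0 -mulr2n -mulr_natl mulf_eq0 (negPf ell_two_neq0).
Qed.

Lemma ell_same_x (x y1 y2 : K) :
  on (Some (x, y1)) -> on (Some (x, y2)) -> y1 != - y2 -> y2 = y1.
Proof.
move=> /eqP H1 /eqP H2 yN; apply/eqP; rewrite eq_sym -subr_eq0.
have yN' : y1 + y2 != 0 by rewrite addr_eq0.
by rewrite -(inj_eq (mulIf yN')) mul0r -subr_sqr H1 H2 subrr.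
Qed.

(* The line y = m * x + c meets the curve at abscissae x1, x2, x3, counted
   with multiplicity. *)
Definition ell_line (m c x1 x2 x3 : K) : Prop :=
  [/\ x1 + x2 + x3 = m ^+ 2,
      x1 * x2 + x1 * x3 + x2 * x3 = ellA E - 2%:R * m * c
    & x1 * x2 * x3 = c ^+ 2 - ellB E].

Lemma ell_line_on m c x1 x2 x3 :
  ell_line m c x1 x2 x3 -> on (Some (x1, m * x1 + c)).
Proof.
case=> e1 e2 e3; apply/eqP.
have -> : ellA E = x1 * x2 + x1 * x3 + x2 * x3 + 2%:R * m * c.
  by rewrite e2 subrK.
have -> : ellB E = c ^+ 2 - x1 * x2 * x3 by rewrite e3 subKr.
have -> : (m * x1 + c) ^+ 2 = m ^+ 2 * x1 ^+ 2 + 2%:R * m * c * x1 + c ^+ 2.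
  by ring.
by rewrite -e1; ring.
Qed.

Lemma ell_line_rot m c x1 x2 x3 :
  ell_line m c x1 x2 x3 -> ell_line m c x3 x2 x1.
Proof. by case=> e1 e2 e3; split; rewrite -?e1 -?e2 -?e3; ring. Qed.

Lemma ell_add_line m c x1 x2 x3 : ell_line m c x1 x2 x3 ->
  Some (x1, m * x1 + c) +' Some (x2, m * x2 + c) = Some (x3, - (m * x3 + c)).
Proof.
move=> L; have /eqP H1 := ell_line_on L; case: L => e1 e2 e3 /=.
have x3E : x3 = m ^+ 2 - x1 - x2 by rewrite -e1; ring.
have aE : ellA E = x1 * x2 + x1 * x3 + x2 * x3 + 2%:R * m * c.
  by rewrite e2 subrK.
case: eqVneq => [xE|xN] /=.
  subst x2; rewrite ell_eq_opp; case: eqVneq => [y0|yN].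
    have := ell_smooth H1 y0; rewrite aE.
    have -> : c = - (m * x1) by apply/eqP; rewrite -addr_eq0 addrC y0.
    by case/eqP; rewrite x3E; ring.
  have -> : ell_slope x1 (m * x1 + c) x1 (m * x1 + c) = m.
    rewrite /ell_slope eqxx aE x3E; apply: (mulIf (mulf_neq0 ell_two_neq0 yN)).
    by rewrite divfK ?mulf_neq0 ?ell_two_neq0 //; ring.
  by rewrite -x3E; congr Some; congr pair; ring.
have -> : ell_slope x1 (m * x1 + c) x2 (m * x2 + c) = m.
  rewrite /ell_slope (negPf xN).
  have d : x2 - x1 != 0 by rewrite subr_eq0 eq_sym.
  by apply: (mulIf d); rewrite divfK //; ring.
by rewrite -x3E; congr Some; congr pair; ring.
Qed.

Lemma ell_line_ex x1 y1 x2 y2 :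
  on (Some (x1, y1)) -> on (Some (x2, y2)) -> ~~ ((x1 == x2) && (y1 == - y2)) ->
  exists m c x3,
    [/\ y1 = m * x1 + c, y2 = m * x2 + c & ell_line m c x1 x2 x3].
Proof.
move=> o1 o2 N; have /eqP H1 := o1; have /eqP H2 := o2.
pose m := ell_slope x1 y1 x2 y2.
exists m, (y1 - m * x1), (m ^+ 2 - x1 - x2); rewrite /ell_line /m /ell_slope.
case: (eqVneq x1 x2) N => [xE|xN] /= N.
  subst x2; have yE := ell_same_x o1 o2 N; subst y2.
  have y0 : y1 != 0 by rewrite -ell_eq_opp.
  have t0 := ell_two_neq0.
  split=> //; [by ring|by ring|].
  have bE : ellB E = y1 ^+ 2 - x1 ^+ 3 - ellA E * x1 by rewrite H1; ring.
  by rewrite bE; split; field: H1; rewrite ?y0 ?t0.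
have d : x2 - x1 != 0 by rewrite subr_eq0 eq_sym.
have aE : ellA E = (y2 ^+ 2 - y1 ^+ 2 - x2 ^+ 3 + x1 ^+ 3) / (x2 - x1).
  by rewrite H1 H2; field.
have bE : ellB E = y1 ^+ 2 - x1 ^+ 3 - ellA E * x1 by rewrite H1; ring.
by split; [ring|field|rewrite bE aE; split; field].
Qed.

Lemma ell_addC P Q : on P -> on Q -> P +' Q = Q +' P.
Proof.
case: P => [[x1 y1]|]; case: Q => [[x2 y2]|] // o1 o2.
case N: ((x1 == x2) && (y1 == - y2)).
  case/andP: (N) => /eqP xE /eqP yE.
  by rewrite /= N xE yE opprK !eqxx.
have [m [c [x3 [-> -> L]]]] := ell_line_ex o1 o2 (negbT N).
rewrite (ell_add_line L) (@ell_add_line m c x2 x1 x3) //.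
by case: L => e1 e2 e3; split; rewrite -?e1 -?e2 -?e3; ring.
Qed.

Lemma on_opp P : on P -> on (opp P).
Proof. by case: P => [[x y]|] //=; rewrite sqrrN. Qed.

Lemma on_add P Q : on P -> on Q -> on (P +' Q).
Proof.
case: P => [[x1 y1]|]; case: Q => [[x2 y2]|] // o1 o2.
case N: ((x1 == x2) && (y1 == - y2)); first by rewrite /= N.
have [m [c [x3 [-> -> L]]]] := ell_line_ex o1 o2 (negbT N).
rewrite (ell_add_line L) -[Some _]/(opp (Some (x3, m * x3 + c))).
exact/on_opp/(ell_line_on (ell_line_rot L)).
Qed.

Lemma ell_oppK P : opp (opp P) = P.
Proof. by case: P => [[x y]|] //=; rewrite opprK. Qed.

Lemma ell_addN P : P +' opp P = None.
Proof. by case: P => [[x y]|] //=; rewrite opprK !eqxx. Qed.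

Lemma ell_add0 P : P +' None = P.
Proof. by case: P => [[]|]. Qed.

Lemma ell_add_eq0 P Q : P +' Q = None -> P = opp Q.
Proof.
by case: P Q => [[x1 y1]|] [[x2 y2]|] //=; case: andP => // -[/eqP-> /eqP->].
Qed.

Lemma ell_oppD P Q : opp (P +' Q) = opp P +' opp Q.
Proof.
case: P Q => [[x1 y1]|] [[x2 y2]|] //=.
rewrite eqr_oppLR opprK; case: ifP => // _; rewrite /= /ell_slope.
case: eqP => _; first rewrite !mulrN invrN mulrN sqrrN.
  by congr Some; congr pair; ring.
rewrite -opprD mulNr sqrrN.
by congr Some; congr pair; ring.
Qed.

Lemma ell_addK P Q : on P -> on Q -> P +' Q +' opp Q = P.
Proof.
case: P => [[x1 y1]|]; last by case: Q => [[x y]|] //= _ _; rewrite opprK !eqxx.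
case: Q => [[x2 y2]|] // o1 o2.
case N: ((x1 == x2) && (y1 == - y2)).
  by rewrite [_ +' _]/= N; case/andP: N => /eqP -> /eqP ->.
have [m [c [x3 [-> -> L]]]] := ell_line_ex o1 o2 (negbT N).
rewrite (ell_add_line L).
have := congr1 opp (ell_add_line (ell_line_rot L)).
by rewrite ell_oppD [opp (Some (x1, _))]/= opprK.
Qed.

Lemma ell_addI P Q R : on P -> on Q -> on R -> P +' Q = P +' R -> Q = R.
Proof.
move=> oP oQ oR e.
by rewrite -(ell_addK oQ oP) -(ell_addK oR oP) !(@ell_addC _ P) // e.
Qed.

Definition ell_neq_x (P Q : option (K * K)) : bool :=
  if P is Some (x1, _) then if Q is Some (x2, _) then x1 != x2 else false
  else false.

Local Notation "P <>x Q" := (ell_neq_x P Q) (at level 70).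

Lemma ell_neq_xP P Q : on P -> on Q -> ~~ (P <>x Q) ->
  [\/ P = None, Q = None, P = opp Q | P = Q].
Proof.
case: P Q => [[x1 y1]|] [[x2 y2]|] o1 o2 N; try by [constructor 1|constructor 2].
move: N; rewrite /= negbK => /eqP xE; subst x2.
have [->|yN] := eqVneq y1 (- y2); first by constructor 3.
by constructor 4; rewrite (ell_same_x o1 o2 yN).
Qed.

Lemma ell_add_neq x1 y1 x2 y2 : x1 != x2 ->
  let m := (y2 - y1) / (x2 - x1) in
  let x3 := m ^+ 2 - x1 - x2 in
  Some (x1, y1) +' Some (x2, y2) = Some (x3, m * (x1 - x3) - y1).
Proof. by move=> N; rewrite /= /ell_slope (negPf N). Qed.

Lemma ell_add_dbl x y : y != 0 ->
  let m := (3%:R * x ^+ 2 + ellA E) / (2%:R * y) in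
  let x3 := m ^+ 2 - x - x in
  Some (x, y) +' Some (x, y) = Some (x3, m * (x - x3) - y).
Proof. by move=> N; rewrite /= /ell_slope eqxx ell_eq_opp (negPf N). Qed.

Lemma ell_neq_opp x y : Some (x, y) <> opp (Some (x, y)) -> y != 0.
Proof. by move=> N; apply: contra_not_neq N => -> /=; rewrite oppr0. Qed.

Lemma ell_addA_gen P Q R : on P -> on Q -> on R ->
  P <>x Q -> Q <>x R -> (P +' Q) <>x R -> P <>x (Q +' R) ->
  P +' Q +' R = P +' (Q +' R).
Proof.
case: P Q R => [[x1 y1]|] [[x2 y2]|] [[x3 y3]|] //.
move=> /eqP H1 /eqP H2 /eqP H3 N12 N23.
rewrite (ell_add_neq _ _ N12) (ell_add_neq _ _ N23) => N12_3 N1_23.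
rewrite (ell_add_neq _ _ N12_3) (ell_add_neq _ _ N1_23).
have d12 : x2 - x1 != 0 by rewrite subr_eq0 eq_sym.
have d23 : x3 - x2 != 0 by rewrite subr_eq0 eq_sym.
have d12_3 : x3 * (x2 - x1) ^+ 2 -
    ((y2 - y1) ^+ 2 + - x1 * (x2 - x1) ^+ 2 + - x2 * (x2 - x1) ^+ 2) != 0.
  move: N12_3; apply: contraNneq => e; rewrite eq_sym -subr_eq0; apply/eqP.
  by apply/(mulIf (expf_neq0 2 d12)); rewrite mul0r -e; field; exact: d12.
have d1_23 : (y3 - y2) ^+ 2 + - x2 * (x3 - x2) ^+ 2 + - x3 * (x3 - x2) ^+ 2
    + - x1 * (x3 - x2) ^+ 2 != 0.
  move: N1_23; apply: contraNneq => e; rewrite eq_sym -subr_eq0; apply/eqP.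
  by apply/(mulIf (expf_neq0 2 d23)); rewrite mul0r -e; field; exact: d23.
by congr Some; congr pair; field: H1 H2 H3; rewrite d12 d23 d12_3 d1_23.
Qed.

Lemma ell_addA_dbl_gen P R : on P -> on R -> P <> opp P ->
  P <>x R -> (P +' P) <>x R -> P <>x (P +' R) ->
  P +' P +' R = P +' (P +' R).
Proof.
case: P R => [[x1 y1]|] [[x3 y3]|] //.
move=> /eqP H1 /eqP H3 /ell_neq_opp y1N N13.
rewrite (ell_add_neq _ _ N13) (ell_add_dbl _ y1N) => N11_3 N1_13.
rewrite (ell_add_neq _ _ N11_3) (ell_add_neq _ _ N1_13).
have t0 := ell_two_neq0; have f0 := mulf_neq0 t0 y1N.
have d13 : x3 - x1 != 0 by rewrite subr_eq0 eq_sym.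
have d11_3 : x3 * (4%:R * y1 ^+ 2) - ((3%:R * x1 ^+ 2 + ellA E) ^+ 2
    + - x1 * (4%:R * y1 ^+ 2) + - x1 * (4%:R * y1 ^+ 2)) != 0.
  move: N11_3; apply: contraNneq => e; rewrite eq_sym -subr_eq0; apply/eqP.
  apply/(mulIf (expf_neq0 2 f0)); rewrite mul0r -e; field.
  by rewrite y1N t0.
have d1_13 : (y3 - y1) ^+ 2 + - x1 * (x3 - x1) ^+ 2 + - x3 * (x3 - x1) ^+ 2
    + - x1 * (x3 - x1) ^+ 2 != 0.
  move: N1_13; apply: contraNneq => e; rewrite eq_sym -subr_eq0; apply/eqP.
  by apply/(mulIf (expf_neq0 2 d13)); rewrite mul0r -e; field; exact: d13.
by congr Some; congr pair; field: H1 H3; rewrite y1N t0 d13 d11_3 d1_13.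
Qed.

Lemma ell_addA_dbl2 P : on P -> P <> opp P -> P +' P <> opp (P +' P) ->
  P <>x (P +' P) -> P <>x (P +' (P +' P)) ->
  P +' P +' (P +' P) = P +' (P +' (P +' P)).
Proof.
case: P => [[x y]|] // /eqP H /ell_neq_opp yN.
rewrite (ell_add_dbl _ yN) => /ell_neq_opp tN N12.
rewrite (ell_add_neq _ _ N12) (ell_add_dbl _ tN) => N1_12.
rewrite (ell_add_neq _ _ N1_12).
have t0 := ell_two_neq0; have f0 := mulf_neq0 t0 yN.
pose M := 3%:R * x ^+ 2 + ellA E; pose w := 4%:R * y ^+ 2.
have c1 : M ^+ 2 + - x * w + - x * w + - x * w != 0.
  move: N12; apply: contraNneq => e; rewrite eq_sym -subr_eq0; apply/eqP.
  apply/(mulIf (expf_neq0 2 f0)); rewrite mul0r -e /M /w; field.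
  by rewrite yN t0.
have c2 : M * (x * w - (M ^+ 2 + - x * w + - x * w)) + - y * (2%:R * y * w)
    != 0.
  move: tN; apply: contraNneq => e; apply/eqP.
  apply/(mulIf (expf_neq0 3 f0)); rewrite mul0r -e /M /w; field.
  by rewrite yN t0.
have c3 : (M * (x * w - (M ^+ 2 + - x * w + - x * w)) + - y * (2%:R * y * w)
      + - y * (2%:R * y * w)) ^+ 2
    + - x * (w * (M ^+ 2 + - x * w + - x * w + - x * w) ^+ 2)
    + - (M ^+ 2 + - x * w + - x * w)
      * (M ^+ 2 + - x * w + - x * w + - x * w) ^+ 2
    + - x * ((M ^+ 2 + - x * w + - x * w + - x * w) ^+ 2 * w) != 0.
  move: N1_12; apply: contraNneq => e; rewrite eq_sym -subr_eq0; apply/eqP.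
  apply/(mulIf (mulf_neq0 (expf_neq0 2 f0) (expf_neq0 2 c1))).
  by rewrite mul0r -e /M /w; field; rewrite yN t0 c1.
by congr Some; congr pair; field: H; rewrite yN t0 c1 c2 c3.
Qed.

Lemma ell_addA_cases P Q R : on P -> on Q -> on R ->
  [\/ P = None, Q = None, R = None | P = R] \/
  [\/ P = opp Q, Q = opp R, P +' Q = opp R | P = opp (Q +' R)] ->
  P +' Q +' R = P +' (Q +' R).
Proof.
move=> oP oQ oR [] [] e.
- by rewrite e.
- by rewrite e ell_add0.
- by rewrite e !ell_add0.
- by rewrite e ell_addC ?on_add // (ell_addC oR oQ).
- rewrite e (ell_addC (on_opp oQ) oQ) ell_addN (ell_addC (on_opp oQ)) ?on_add //.
  by rewrite (ell_addC oQ oR) ell_addK.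
- rewrite e (ell_addC (on_opp oR) oR) ell_addN ell_add0.
  by have := ell_addK oP (on_opp oR); rewrite ell_oppK.
- have -> : R = opp (P +' Q) by rewrite e ell_oppK.
  rewrite ell_addN ell_oppD (ell_addC oQ) ?on_add ?on_opp //.
  have := ell_addK (on_opp oP) (on_opp oQ); rewrite ell_oppK => ->.
  by rewrite ell_addN.
have -> : P +' (Q +' R) = None by rewrite e ell_addC ?on_opp ?on_add // ell_addN.
rewrite e ell_oppD (ell_addC (on_opp oQ) (on_opp oR)).
have := ell_addK (on_opp oR) (on_opp oQ); rewrite ell_oppK => ->.
by rewrite ell_addC ?on_opp // ell_addN.
Qed.

Local Ltac degenerate :=
  apply: ell_addA_cases => //;
  solve [ left; constructor 1; assumption | left; constructor 2; assumption
        | left; constructor 3; assumption | left; constructor 4; assumption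
        | right; constructor 1; assumption | right; constructor 2; assumption
        | right; constructor 3; assumption | right; constructor 4; assumption ].

Lemma ell_add_id P Q : on P -> on Q -> P = P +' Q -> Q = None.
Proof. by move=> oP oQ e; apply: (@ell_addI P Q None) => //; rewrite ell_add0 -e. Qed.

Lemma ell_addA_dbl P R : on P -> on R -> P +' P +' R = P +' (P +' R).
Proof.
move=> oP oR.
have [e|P0] := eqVneq P None; first by degenerate.
have [e|R0] := eqVneq R None; first by degenerate.
have [e|PR] := eqVneq P R; first by degenerate.
have [e|PN] := eqVneq P (opp P); first by degenerate.
have [e|PRN] := eqVneq P (opp R); first by degenerate.
have [e|PP] := eqVneq (P +' P) (opp R); first by degenerate.
have [e|PPR] := eqVneq P (opp (P +' R)).
  by degenerate.
have neqx S : on S -> S != None -> P != opp S -> (P <>x S) || (P == S).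
  move=> oS S0 PS; case N: (P <>x S) => //.
  by case: (ell_neq_xP oP oS (negbT N)) => e; move: P0 S0 PS; rewrite -?e ?eqxx.
have PxS S : on S -> P +' S != None -> S != None -> P != opp (P +' S) ->
    P <>x (P +' S).
  move=> oS PS0 S0 PS; case/orP: (neqx _ (on_add oP oS) PS0 PS) => // /eqP e.
  by rewrite (ell_add_id oP oS e) in S0.
have PR0 : P +' R != None by apply: contra_neq PRN => /ell_add_eq0.
have PP0 : P +' P != None by apply: contra_neq PN => /ell_add_eq0.
have PxR : P <>x R by have := neqx _ oR R0 PRN; rewrite (negPf PR) orbF.
have PxPR := PxS _ oR PR0 R0 PPR.
case N: ((P +' P) <>x R).
  by apply: ell_addA_dbl_gen => //; exact/eqP.
case: (ell_neq_xP (on_add oP oP) oR (negbT N)) => e.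
- by rewrite e eqxx in PP0.
- by rewrite e eqxx in R0.
- by rewrite e eqxx in PP.
by subst R; apply: ell_addA_dbl2 => //; exact/eqP.
Qed.

Lemma ell_addA_weak P Q R : on P -> on Q -> on R ->
  P +' Q <> R -> P <> Q +' R -> P +' Q +' R = P +' (Q +' R).
Proof.
move=> oP oQ oR PQ_R P_QR.
case PxQ: (P <>x Q); last first.
  case: (ell_neq_xP oP oQ (negbT PxQ)) => e; try by degenerate.
  by subst Q; exact: ell_addA_dbl.
case QxR: (Q <>x R); last first.
  case: (ell_neq_xP oQ oR (negbT QxR)) => e; try by degenerate.
  subst R; rewrite (ell_addC oP (on_add oQ oQ)) ell_addA_dbl //.
  by rewrite (ell_addC oQ oP) (ell_addC (on_add oP oQ) oQ).
case PQxR: ((P +' Q) <>x R); last first.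
  case: (ell_neq_xP (on_add oP oQ) oR (negbT PQxR)) => // e;
    try by degenerate.
  by apply: ell_addA_cases => //; right; constructor 1; apply: ell_add_eq0.
case PxQR: (P <>x (Q +' R)); last first.
  case: (ell_neq_xP oP (on_add oQ oR) (negbT PxQR)) => // e;
    try by degenerate.
  by apply: ell_addA_cases => //; right; constructor 2; apply: ell_add_eq0.
exact: ell_addA_gen.
Qed.

Lemma ell_addA_sum P Q : on P -> on Q ->
  P +' Q +' (P +' Q) = P +' (Q +' (P +' Q)).
Proof.
move=> oP oQ; have oD := on_add oP oQ.
have PE : P = P +' Q +' opp Q by rewrite ell_addK.
set D := P +' Q in oD PE *; have oDD := on_add oD oD.
have oE := on_add oQ oD.
have [e|D0] := eqVneq D None; first by degenerate.
have [e|P0] := eqVneq P None; first by degenerate.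
have [e|QD] := eqVneq Q D.
  have := ell_add_id oQ oP; rewrite (ell_addC oQ oP) -/D => /(_ e) P_0.
  by rewrite P_0 in P0.
have [e|QND] := eqVneq Q (opp D); first by degenerate.
have [e|DDE] := eqVneq (D +' D) (opp (Q +' D)).
  have QE : Q = opp (D +' D) +' opp D.
    by rewrite e ell_oppK ell_addK.
  have -> : Q +' D = opp (D +' D) by rewrite e ell_oppK.
  rewrite [in RHS]PE QE -ell_oppD ell_oppK (ell_addC oDD oD).
  by rewrite -ell_addA_dbl ?ell_addK.
have e : D +' D +' opp D +' opp Q = D +' D +' (opp D +' opp Q).
  apply: ell_addA_weak; rewrite ?on_opp //.
  - by rewrite ell_addK // => e; case/eqP: QND; rewrite e ell_oppK.
  - move=> e; move: DDE; rewrite ell_oppD (ell_addC (on_opp oQ)) ?on_opp //.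
    by rewrite -e eqxx.
rewrite ell_addK // -PE -ell_oppD (ell_addC oD oQ) in e.
rewrite {1}e.
have := ell_addK oDD (on_opp oE); rewrite ell_oppK => -> //.
Qed.

Lemma ell_addA P Q R : on P -> on Q -> on R ->
  P +' Q +' R = P +' (Q +' R).
Proof.
move=> oP oQ oR.
have [<-|N1] := eqVneq (P +' Q) R; first exact: ell_addA_sum.
have [e|N2] := eqVneq P (Q +' R).
  rewrite (ell_addC (on_add oP oQ) oR) (ell_addC oP oQ) (ell_addC oP) ?on_add //.
  by rewrite e (ell_addC oQ oR) ell_addA_sum.
by apply: ell_addA_weak => //; exact/eqP.
Qed.

Definition point_zero : point := @Point None isT.
Definition point_opp (P : point) : point := Point (on_opp (valP P)).
Definition point_add (P Q : point) : point := Point (on_add (valP P) (valP Q)).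

Fact point_addA : associative point_add.
Proof. by move=> P Q R; apply: val_inj; rewrite /= ell_addA //; apply: valP. Qed.

Fact point_addC : commutative point_add.
Proof. by move=> P Q; apply: val_inj; rewrite /= ell_addC //; apply: valP. Qed.

Fact point_add0 : left_id point_zero point_add.
Proof. by move=> P; apply: val_inj. Qed.

Fact point_addN : left_inverse point_zero point_opp point_add.
Proof. by move=> P; rewrite point_addC; apply: val_inj; rewrite /= ell_addN. Qed.

HB.instance Definition _ :=
  GRing.isZmodule.Build point point_addA point_addC point_add0 point_addN.

End EllipticGroup.

Definition Z_independent (A : zmodType) (n : nat) (v : 'I_n -> A) : Prop :=
  forall c : 'I_n -> int, \sum_i v i *~ c i = 0 -> forall i, c i = 0.

(* The rank of an abelian group is the largest size of a Z-linearly
   independent family, that is the dimension of its tensor product with Q. *)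
Definition has_rank (A : zmodType) (r : nat) : Prop :=
  (exists v : 'I_r -> A, Z_independent v) /\
  (forall (n : nat) (v : 'I_n -> A), Z_independent v -> (n <= r)%N).

Definition legendre (a : int) (p : nat) : int :=
  if (p %| a)%Z then 0
  else if [exists x : 'I_p, (x%:Z ^+ 2 == a %[mod p])%Z] then 1 else -1.

Notation Qi := (rat[i]).

Fact E_disc_neq0 (p q : nat) (pr_p : prime p) (pr_q : prime q) :
  - 16%:R * (4%:R * (- (p * q)%:R) ^+ 3 + 27%:R * 0 ^+ 2) != 0 :> Qi.
Proof.
have n0 (n : nat) : (0 < n)%N -> n%:R != 0 :> Qi.
  move=> n_gt0; rewrite -(rmorph_nat (real_complex rat)) fmorph_eq0.
  by rewrite pnatr_eq0 -lt0n.
rewrite expr0n mulr0 addr0 mulf_neq0 ?oppr_eq0 ?n0 // mulf_neq0 ?n0 //.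
by rewrite expf_neq0 // oppr_eq0 n0 // muln_gt0 !prime_gt0.
Qed.

(* y ^+ 2 = x ^+ 3 - p * q * x over Q(i). *)
Definition E_pq (p q : nat) (pr_p : prime p) (pr_q : prime q) : ellCurve Qi :=
  EllCurve (E_disc_neq0 pr_p pr_q).

(* Main.v *)
Require Import Defs.
From HB Require Import structures.
From mathcomp Require Import all_boot all_order all_algebra finfield zify ring.

(** If [s] denotes complex conjugation and [P] is a point over Q(i), then
    [P + s P] is rational, and [P - s P] becomes rational after
    [(x, y) |-> (- x, i y)], which maps the curve to itself. It is therefore
    enough that every rational point of y^2 = x^3 - n x, with n = p q, has
    y = 0; all points over Q(i) are then killed by 4.

    A rational point has x = a / e^2, and a = +- g M^2 with g dividing n, which
    gives a coprime solution of N^2 + b v^4 = a u^4 with a b = n. Congruences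
    modulo 16, p and q exclude everything but N^2 + n v^4 = u^4. Factoring
    n v^4 = (u^2 - N) (u^2 + N) leads to u^2 = d r^4 + 4 (n / d) s^4 with
    v = 2 r s, or to 2 u^2 = d r^4 + (n / d) s^4. Congruences leave only d = 1
    and d = n in the first equation, and a second factorisation then produces
    a solution of the original equation with a smaller v. Only the two
    supplementary laws are used, never quadratic reciprocity. *)

Set Implicit Arguments.
Unset Strict Implicit.
Unset Printing Implicit Defensive.
Import Order.TTheory GRing.Theory Num.Theory.

Local Open Scope ring_scope.

(** * Squares modulo m, and the quadratic characters of 2 and -2 *)

Definition sqmod (m : nat) (t : int) : Prop :=
  exists x : int, (m %| x ^+ 2 - t)%Z.

(** As [m] is odd, a residue [r] and [m - r] have opposite parity, so one root is odd. Its square is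
    1 modulo 8, which drives the two descents below; there [m] may be composite. *)
Lemma sqmod_odd_rep (m : nat) (t : int) :
  odd m -> ~~ (m %| t)%Z -> sqmod m t ->
  exists b k : int,
    0 < 2 * b + 1 < m%:Z /\ (2 * b + 1) ^+ 2 - t = k * m%:Z.
Proof.
move=> om mt [x /dvdzP[k ek]].
pose r := (x %% m)%Z; pose c := (x %/ m)%Z.
have xE : x = c * m%:Z + r by exact: divz_eq.
have er : r ^+ 2 - t = (k - c * (x + r)) * m%:Z.
  by rewrite mulrBl -ek {2}xE {1}xE; ring.
have r_neq0 : r != 0.
  apply: contraNneq mt => r0; apply/dvdzP.
  by exists (- (k - c * (x + r))); rewrite mulNr -er r0; ring.
have rm : 0 < r < m%:Z by lia.
case o: (r %% 2 == 1)%Z.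
  exists (r %/ 2)%Z, (k - c * (x + r)).
  have -> : 2 * (r %/ 2)%Z + 1 = r by lia.
  by split; [lia|].
exists ((m%:Z - r) %/ 2)%Z, (k - c * (x + r) + m%:Z - 2 * r).
have -> : 2 * ((m%:Z - r) %/ 2)%Z + 1 = m%:Z - r by lia.
split; first lia.
have -> : (m%:Z - r) ^+ 2 - t = r ^+ 2 - t + (m%:Z - 2 * r) * m%:Z by ring.
by rewrite er; ring.
Qed.

Lemma pronic_even (b : int) : exists g, b * (b + 1) = 2 * g.
Proof.
have [h [->|->]] : exists h, b = 2 * h \/ b = 2 * h + 1.
- by exists (b %/ 2)%Z; lia.
- by exists (h * (2 * h + 1)); ring.
- by exists ((2 * h + 1) * (h + 1)); ring.
Qed.

(* Infinite descent: for odd [0 < a < m] the cofactor of [m] in [a ^ 2 - t] is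
   smaller than [m], and it lies in the same pair of classes mod 8. *)
Lemma two_nonsquare (m : nat) :
  (m %% 8 = 3)%N \/ (m %% 8 = 5)%N -> ~ sqmod m 2.
Proof.
elim/ltn_ind: m => m IH m8 sq.
have m2 : ~~ (m %| 2)%Z by rewrite dvdzE /=; apply/negP => /dvdn_leq; lia.
have [|b [k [ab e]]] := @sqmod_odd_rep m 2 _ m2 sq; first lia.
have [g gE] := pronic_even b.
have eq8 : k * m%:Z = 8 * g - 1.
  rewrite -e; have -> : 8 * g = 4 * (2 * g) by ring.
  by rewrite -gE; ring.
have k0 : 0 < k by nia.
have km : k < m%:Z by nia.
have [f fE] : exists f, m%:Z = 8 * f + 3 \/ m%:Z = 8 * f + 5.
  by exists (m %/ 8)%:Z; lia.
have k8 : (`|k| %% 8 = 3)%N \/ (`|k| %% 8 = 5)%N.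
  by case: fE => fE; move: eq8; rewrite fE mulrDr mulrCA; lia.
apply: (IH `|k|%N) => //; first by lia.
by exists (2 * b + 1); rewrite e gtz0_abs //; exact: dvdz_mulr.
Qed.

(** Same descent: an odd square plus 2 is 3 modulo 8, so [m] and its cofactor exchange the classes 5
    and 7, and [(m - 1) ^ 2 + 2 < m ^ 2] makes the cofactor smaller. *)
Lemma neg_two_nonsquare (m : nat) :
  (m %% 8 = 5)%N \/ (m %% 8 = 7)%N -> ~ sqmod m (- 2).
Proof.
elim/ltn_ind: m => m IH m8 sq.
have m2 : ~~ (m %| - 2)%Z by rewrite dvdzE /=; apply/negP => /dvdn_leq; lia.
have [|b [k [ab e]]] := @sqmod_odd_rep m (- 2) _ m2 sq; first lia.
have [g gE] := pronic_even b.
have eq8 : k * m%:Z = 8 * g + 3.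
  rewrite -e; have -> : 8 * g = 4 * (2 * g) by ring.
  by rewrite -gE; ring.
have k0 : 0 < k by nia.
have aa : (2 * b + 1) * (2 * b + 1) <= (m%:Z - 1) * (m%:Z - 1).
  by apply: ler_pM; lia.
have km : k < m%:Z.
  rewrite ltNge; apply/negP => mk.
  have : m%:Z * m%:Z <= k * m%:Z by rewrite ler_pM2r //; lia.
  by rewrite -e; lia.
have [f fE] : exists f, m%:Z = 8 * f + 5 \/ m%:Z = 8 * f + 7.
  by exists (m %/ 8)%:Z; lia.
have k8 : (`|k| %% 8 = 5)%N \/ (`|k| %% 8 = 7)%N.
  by case: fE => fE; move: eq8; rewrite fE mulrDr mulrCA; lia.
apply: (IH `|k|%N) => //; first by lia.
by exists (2 * b + 1); rewrite e gtz0_abs //; exact: dvdz_mulr.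
Qed.


(** * Squares modulo a prime *)

Lemma sqmodP (q : nat) (t : int) : prime q ->
  sqmod q t <-> exists x : 'F_q, x ^+ 2 = t%:~R.
Proof.
move=> pr_q; have ch := pchar_Fp pr_q; split=> [[x]|[x xE]].
  rewrite (dvdz_pcharf ch) rmorphB rmorphXn /= subr_eq0 => /eqP e.
  by exists x%:~R.
exists (x : nat)%:Z; rewrite (dvdz_pcharf ch) rmorphB rmorphXn /= subr_eq0.
by rewrite -xE -pmulrn natr_Zp.
Qed.

Lemma Fp_Fermat (q : nat) (x : 'F_q) : prime q -> x ^+ q = x.
Proof. by move=> pr_q; rewrite -{2}(expf_card x) card_Fp. Qed.

(** With [q = 4 k + 1], at most [2 k] of the [4 k] nonzero residues satisfy [x ^ (2 k) = 1]. Any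
    other has [x ^ (2 k) = -1] by Fermat, and [x ^ k] is the root. *)
Lemma neg_one_square (q : nat) : prime q -> (q %% 4 = 1)%N -> sqmod q (- 1).
Proof.
move=> pr_q q4; apply/sqmodP => //; rewrite rmorphN1.
pose k := (q %/ 4)%N; have qE : q = (4 * k + 1)%N by lia.
have q1 := prime_gt1 pr_q.
have [x x0 xk] : exists2 x : 'F_q, x != 0 & x ^+ (2 * k) != 1.
  apply/exists_inP; apply: contraT => /exists_inPn H.
  have : (size (enum (predC1 (0%R : 'F_q))) <= 2 * k)%N.
    apply: max_unity_roots; rewrite ?enum_uniq //; first lia.
    apply/allP => x; rewrite mem_enum => x0; rewrite unity_rootE.
    by have := H x x0; rewrite negbK.
  by rewrite -cardE cardC1 card_Fp //; lia.
exists (x ^+ k); apply/eqP; rewrite -exprM -subr_eq0 opprK.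
have : (x ^+ (2 * k) - 1) * (x ^+ (k * 2) + 1) == 0.
  rewrite mulnC -subr_sqr -exprM expr1n subr_eq0.
  rewrite -(inj_eq (mulIf x0)) -exprSr mul1r (_ : _.+1 = q) ?Fp_Fermat //; lia.
by rewrite mulf_eq0 subr_eq0 (negPf xk).
Qed.

(** If [x ^ 2 = -1], Fermat gives [x = x ^ q = - x], since [(q - 1) / 2] is odd. *)
Lemma neg_one_nonsquare (q : nat) : prime q -> (q %% 4 = 3)%N ->
  ~ sqmod q (- 1).
Proof.
move=> pr_q q4 /(sqmodP _ pr_q)[x]; rewrite rmorphN1 => x2.
pose k := (q %/ 4)%N; have qE : q = (2 * (2 * k + 1) + 1)%N by lia.
have x0 : x != 0.
  by apply: contra_eq_neq x2 => ->; rewrite expr0n eq_sym oppr_eq0 oner_eq0.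
have : x ^+ (2 * (2 * k + 1) + 1) = x by rewrite -qE Fp_Fermat.
rewrite exprD exprM x2 expr1.
rewrite -signr_odd oddD oddM /= expr1 mulN1r => /eqP.
rewrite eq_sym -addr_eq0 -mulr2n -mulr_natr mulf_eq0 (negPf x0) /=.
rewrite -(dvdn_pcharf (pchar_Fp pr_q)) => /dvdn_leq; lia.
Qed.

(** The power [u ^ ((q + 1) / 4)] has fourth power [u ^ (q + 1) = u ^ 2], so its square is [u] or
    [- u]; the first is excluded. *)
Lemma sqmod_neg (q : nat) (t : int) : prime q -> (q %% 4 = 3)%N ->
  ~ sqmod q t -> sqmod q (- t).
Proof.
move=> pr_q q4 nsq; apply/sqmodP => //; rewrite rmorphN.
have {}nsq (x : 'F_q) : x ^+ 2 != t%:~R.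
  by apply: contra_notN nsq => /eqP e; apply/sqmodP => //; exists x.
set u : 'F_q := t%:~R in nsq *.
pose k := (q %/ 4)%N; have qE : q = (4 * k + 3)%N by lia.
exists (u ^+ (k + 1)); apply/eqP; rewrite -addr_eq0.
have : (u ^+ (k + 1) ^+ 2 - u) * (u ^+ (k + 1) ^+ 2 + u) == 0.
  rewrite -subr_sqr -!exprM subr_eq0 (_ : _ * 2 * 2 = q + 1)%N; last lia.
  by rewrite exprD Fp_Fermat.
by rewrite mulf_eq0 subr_eq0 (negPf (nsq _)).
Qed.

Lemma sqmod_mulK (q : nat) (s t : int) : prime q -> ~~ (q %| s)%Z ->
  sqmod q s -> sqmod q (s * t) -> sqmod q t.
Proof.
move=> pr_q; rewrite (dvdz_pcharf (pchar_Fp pr_q)) => s0.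
move=> /(sqmodP _ pr_q)[x xE] /(sqmodP _ pr_q)[y yE].
apply/sqmodP => //; exists (y / x).
by rewrite expr_div_n xE yE rmorphM /= mulrC mulKf.
Qed.

Lemma legendreN1 (q : nat) (a : int) : (0 < q)%N ->
  legendre a q = -1 -> ~ sqmod q a.
Proof.
move=> q0; rewrite /legendre; case: ifP => // _; case: ifP => // /existsPn H _.
case=> x dx.
have rq : (`|(x %% q)%Z| < q)%N by lia.
have /negP := H (Ordinal rq); apply.
have -> : (Ordinal rq)%:Z = (x %% q)%Z by rewrite /=; lia.
by rewrite modzXm eqz_mod_dvd.
Qed.

Lemma legendre1 (q : nat) (a : int) : legendre a q = 1 ->
  ~~ (q %| a)%Z /\ sqmod q a.
Proof.
rewrite /legendre; case: ifP => // _; case: ifP => // /existsP[x].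
by rewrite eqz_mod_dvd; split=> //; exists x.
Qed.

(* [q] cannot divide [w]: it would divide [X], so [q ^ 2] would divide
   [q k z ^ 4]. *)
Lemma sqmod_of_quartic (q : nat) (X t k w z : int) : prime q ->
  coprimez w z -> ~~ (q %| k)%Z -> X ^+ 2 = t * w ^+ 4 + q%:Z * k * z ^+ 4 ->
  sqmod q t.
Proof.
move=> pr_q cwz qk e; have ch := pchar_Fp pr_q.
have dpX (x : int) n : (q %| x ^+ n.+1)%Z = (q %| x)%Z.
  by rewrite !(dvdz_pcharf ch) rmorphXn /= expf_eq0.
have dpM (x y : int) : (q %| x * y)%Z = (q %| x)%Z || (q %| y)%Z.
  by rewrite !(dvdz_pcharf ch) rmorphM /= mulf_eq0.
have qw : ~~ (q %| w)%Z.
  apply/negP => qw; have qX : (q %| X)%Z.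
    rewrite -(dpX X 1%N) e rpredD //; first by rewrite dvdz_mull ?dpX.
    by rewrite -mulrA dvdz_mulr.
  have : (q %| k * z ^+ 4)%Z.
    case/dvdzP: qX e => X' ->; case/dvdzP: qw => w' -> e.
    have q0 : q%:Z != 0 by have := prime_gt0 pr_q; lia.
    apply/dvdzP; exists (X' ^+ 2 - t * w' ^+ 4 * q%:Z ^+ 2).
    apply: (mulfI q0).
    have -> : q%:Z * (k * z ^+ 4) = (X' * q%:Z) ^+ 2 - t * (w' * q%:Z) ^+ 4.
      by rewrite e; ring.
    by ring.
  rewrite dpM (negPf qk) dpX /= => qz.
  have := dvdz_gcd q w z; rewrite qw qz (eqP cwz).
  by rewrite dvdzE /= dvdn1 => /eqP q1; rewrite q1 in pr_q.
apply/sqmodP => //; move: qw; rewrite (dvdz_pcharf ch) => w0.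
exists (X%:~R / w%:~R ^+ 2).
have eF : X%:~R ^+ 2 = t%:~R * w%:~R ^+ 4 + q%:R * (k * z ^+ 4)%:~R :> 'F_q.
  by rewrite pmulrn -!rmorphXn -!rmorphM -rmorphD /= mulrA -e.
rewrite expr_div_n eF pcharf0 // mul0r addr0 -exprM.
by rewrite mulfK // expf_neq0.
Qed.

(** * Coprime factorisations and descent *)

Local Open Scope nat_scope.

Lemma coprime_of_gcd_dvd (A B x y : nat) :
  coprime A B -> gcdn x y %| A -> gcdn x y %| B -> coprime x y.
Proof.
move=> /eqP cAB gA gB; rewrite /coprime -dvdn1 -cAB.
by rewrite dvdn_gcd gA gB.
Qed.

Lemma coprime_dvd (x y d e : nat) :
  d %| x -> e %| y -> coprime x y -> coprime d e.
Proof. by move=> dx ey c; exact: coprime_dvdl dx (coprime_dvdr ey c). Qed.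

Lemma coprime_sub_add (U N : nat) :
  N <= U -> odd (U + N) -> coprime U N -> coprime (U - N) (U + N).
Proof.
move=> NU oUN c; set g := gcdn (U - N) (U + N).
have gM : g %| U - N by exact: dvdn_gcdl.
have gP : g %| U + N by exact: dvdn_gcdr.
have g2 : coprime g 2 by rewrite coprime_sym coprime2n; exact: dvdn_odd oUN.
apply: (coprime_of_gcd_dvd c); rewrite -/g -(Gauss_dvdr _ g2).
  have -> : 2 * U = (U - N) + (U + N) by lia.
  by rewrite (dvdn_addr _ gM).
have e : 2 * N + (U - N) = U + N by lia.
by rewrite -(dvdn_addl _ gM) e.
Qed.

(** The root is the part of [z] supported on the primes of [x]: taking that part of both sides keeps
    [x] and turns [y] into 1. *)
Lemma coprime_mul_expn (k x y z : nat) : 0 < x -> 0 < y -> coprime x y ->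
  x * y = z ^ k -> exists r, x = r ^ k.
Proof.
move=> x0 y0 cxy e; exists z`_\pi(x).
rewrite -partnX -e partnM // part_pnat_id ?pnat_pi //.
have : \pi(x)^'.-nat y by rewrite -coprime_pi'.
by rewrite -partn_eq1 // => /eqP ->; rewrite muln1.
Qed.

Lemma coprime_mul_expn2 (k x y z : nat) : 0 < k -> 0 < x -> 0 < y ->
  coprime x y -> x * y = z ^ k ->
  exists r s, [/\ x = r ^ k, y = s ^ k, z = r * s & coprime r s].
Proof.
move=> k0 x0 y0 cxy e; have [r rE] := coprime_mul_expn x0 y0 cxy e.
have [s sE] : exists s, y = s ^ k.
  by apply: (@coprime_mul_expn k y x z); rewrite // 1?coprime_sym 1?mulnC.
exists r, s; split=> //.
  by apply/eqP; rewrite -(eqn_exp2r _ _ k0) -e rE sE expnMn.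
by move: cxy; rewrite rE sE coprime_pexpl // coprime_pexpr.
Qed.

Variant pq_split (p q : nat) : nat -> nat -> Prop :=
| PqSplit1 : pq_split p q 1 (p * q)
| PqSplitN : pq_split p q (p * q) 1
| PqSplitP : pq_split p q p q
| PqSplitQ : pq_split p q q p.

Lemma coprime_mul_prime (p x y w : nat) : prime p -> coprime x y ->
  x * y = p * w ->
  (exists2 x', x = p * x' & x' * y = w) \/
  (exists2 y', y = p * y' & x * y' = w).
Proof.
move=> pr_p cxy e; have p0 := prime_gt0 pr_p.
have : p %| x * y by rewrite e dvdn_mulr.
rewrite Euclid_dvdM // => /orP[/dvdnP[z zE]|/dvdnP[z zE]]; [left|right].
  exists z; first by rewrite zE mulnC.
  by apply/eqP; rewrite -(eqn_pmul2l p0) -e zE; apply/eqP; lia.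
exists z; first by rewrite zE mulnC.
by apply/eqP; rewrite -(eqn_pmul2l p0) -e zE; apply/eqP; lia.
Qed.

(** Removing [p], then [q], from whichever factor it divides leaves coprime numbers with product
    [z ^ 4], hence two fourth powers. *)
Lemma pq_split_quartic (p q x y z : nat) : prime p -> prime q -> 0 < z ->
  coprime x y -> x * y = p * q * z ^ 4 ->
  exists a b r s, [/\ pq_split p q a b, x = a * r ^ 4, y = b * s ^ 4,
                      z = r * s & coprime r s].
Proof.
move=> pr_p pr_q z0 cxy e.
have xy0 : 0 < x * y.
  by rewrite e muln_gt0 expn_gt0 z0 andbT muln_gt0 !prime_gt0.
have fin a b x' y' : x = a * x' -> y = b * y' -> x' * y' = z ^ 4 ->
    pq_split p q a b -> exists a b r s, [/\ pq_split p q a b, x = a * r ^ 4,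
      y = b * s ^ 4, z = r * s & coprime r s].
  move=> xE yE e4 sp; move: xy0; rewrite xE yE.
  rewrite !muln_gt0 => /andP[/andP[a0 x0] /andP[b0 y0]].
  have c' : coprime x' y'.
    by apply: coprime_dvd cxy; rewrite ?xE ?yE dvdn_mull.
  have [r [s [-> -> -> crs]]] := coprime_mul_expn2 (isT : 0 < 4) x0 y0 c' e4.
  by exists a, b, r, s.
rewrite -mulnA in e.
case: (coprime_mul_prime pr_p cxy e) => [[x' xE e']|[y' yE e']].
  have c' : coprime x' y by apply: coprime_dvd cxy; rewrite ?xE ?dvdn_mull.
  case: (coprime_mul_prime pr_q c' e') => [[x2 xE2 e2]|[y2 yE2 e2]].
    by apply: (fin (p * q) 1 x2 y); [lia|lia| |constructor].
  by apply: (fin p q x' y2); [lia|lia| |constructor].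
have c' : coprime x y' by apply: coprime_dvd cxy; rewrite ?yE ?dvdn_mull.
case: (coprime_mul_prime pr_q c' e') => [[x2 xE2 e2]|[y2 yE2 e2]].
  by apply: (fin q p x2 y'); [lia|lia| |constructor].
by apply: (fin 1 (p * q) x y2); [lia|lia| |constructor].
Qed.

(* The homogeneous spaces of y^2 = x^3 - n x, and of its 2-isogenous curve
   (the last two, according to the parity of the variables). *)
Definition minus_insoluble (a b : nat) : Prop :=
  forall N u v, coprime u v -> N ^ 2 + b * v ^ 4 <> a * u ^ 4.

Definition plus_insoluble (a b : nat) : Prop :=
  forall N r s, coprime r s -> odd r -> N ^ 2 <> a * r ^ 4 + 4 * b * s ^ 4.

Definition half_insoluble (a b : nat) : Prop :=
  forall N r s, coprime r s -> odd r -> odd s ->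
  2 * N ^ 2 <> a * r ^ 4 + b * s ^ 4.

(** Up to the symmetry of the half equations, the pairs left out are [(1, p q)] for minus, the
    equation on which the descent runs, and [(1, p q)], [(p q, 1)] for plus, which lead back to
    it. *)
Record selmer_trivial (p q : nat) : Prop := {
  minus_pq_1 : minus_insoluble (p * q) 1;
  minus_p_q : minus_insoluble p q;
  minus_q_p : minus_insoluble q p;
  plus_p_q : plus_insoluble p q;
  plus_q_p : plus_insoluble q p;
  half_1_pq : half_insoluble 1 (p * q);
  half_p_q : half_insoluble p q }.

Lemma half_insolubleC (a b : nat) : half_insoluble a b -> half_insoluble b a.
Proof.
move=> H N r s c od_r od_s; rewrite addnC.
by apply: H; rewrite // coprime_sym.
Qed.

(** For a common prime [l] of [u] and [N], [l ^ 2] divides [p q v ^ 4] and is coprime to [v], so it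
    would divide the squarefree [p q]. *)
Lemma minus_coprime (p q N u v : nat) : prime p -> prime q -> p <> q ->
  0 < u -> coprime u v -> N ^ 2 + p * q * v ^ 4 = u ^ 4 -> coprime u N.
Proof.
move=> pr_p pr_q pq u0 cuv e; apply/negPn/negP => nc.
have [l pr_l /andP[lu lN]] : exists2 l, prime l & (l %| u) && (l %| N).
  have g1 : gcdn u N != 1 by [].
  have g0 : 0 < gcdn u N by rewrite gcdn_gt0 u0.
  exists (pdiv (gcdn u N)); first by apply: pdiv_prime; lia.
  by rewrite -dvdn_gcd pdiv_dvd.
have lv : coprime (l ^ 2) (v ^ 4).
  by rewrite coprime_pexpl // coprime_pexpr //; apply: coprime_dvd cuv.
have : l ^ 2 %| p * q * v ^ 4.
  have l2N : l ^ 2 %| N ^ 2 by rewrite dvdn_pexp2r.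
  rewrite -(dvdn_addr _ l2N) e -[4]/(2 + 2) expnD.
  by rewrite dvdn_mulr // dvdn_pexp2r.
rewrite Gauss_dvdl // => lpq.
have /orP : (l %| p) || (l %| q).
  by rewrite -Euclid_dvdM //; apply: dvdn_trans lpq; rewrite expnS dvdn_mulr.
rewrite !dvdn_prime2 // => -[] /eqP lE; move: lpq; rewrite lE expnS expn1.
  by rewrite dvdn_pmul2l ?prime_gt0 // dvdn_prime2 // => /eqP.
by rewrite dvdn_pmul2r ?prime_gt0 // dvdn_prime2 // => /eqP /esym.
Qed.

Lemma quartic_descent (p q : nat) : prime p -> prime q -> odd p -> odd q ->
  p <> q -> selmer_trivial p q ->
  forall v N u, 0 < v -> coprime u v -> N ^ 2 + p * q * v ^ 4 <> u ^ 4.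
Proof.
move=> pr_p pr_q od_p od_q pq S v; elim/ltn_ind: v => v IH N u v0 cuv e.
have n0 : 0 < p * q by rewrite muln_gt0 !prime_gt0.
have v40 : 0 < p * q * v ^ 4 by rewrite muln_gt0 expn_gt0 v0 andbT.
have e2 : (u ^ 2) ^ 2 = u ^ 4 by rewrite -expnM.
have Nu : N < u ^ 2 by rewrite -ltn_sqr e2 -e; lia.
have u0 : 0 < u by case: (posnP u) Nu => // ->.
have cuN := minus_coprime pr_p pr_q pq u0 cuv e.
have cu2N : coprime (u ^ 2) N by rewrite coprime_pexpl.
have exy : (u ^ 2 - N) * (u ^ 2 + N) = p * q * v ^ 4.
  by rewrite -subn_sqr e2 -e addKn.
have pars : odd u (+) odd N = odd v.
  have := congr1 odd e; rewrite oddD !oddX oddM oddX (oddM p) /= od_p od_q.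
  by case: (odd u); case: (odd N); case: (odd v).
(* The second factorisation: writing [y = a f ^ 4] and [x = b g ^ 4] gives
   [M ^ 2 + b g ^ 4 = a f ^ 4]. For [a = 1] this is the original equation with [g <= z < v]; the
   other splittings are insoluble. *)
have step x y z M : coprime x y -> x * y = p * q * z ^ 4 -> y = x + M ^ 2 ->
    0 < z < v -> False.
  move=> cxy xyE yE /andP[z0 zv].
  rewrite mulnC in xyE; rewrite coprime_sym in cxy.
  have [a [b [f [g [sp fE gE zE cfg]]]]] :=
    pq_split_quartic pr_p pr_q z0 cxy xyE.
  have {yE}eq : M ^ 2 + b * g ^ 4 = a * f ^ 4 by rewrite -gE -fE addnC.
  case: sp eq => eq.
  - move: z0 zv; rewrite mul1n in eq; rewrite zE muln_gt0 => /andP[f0 g0] zv.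
    exact: (IH g (leq_ltn_trans (leq_pmull g f0) zv) M f g0 cfg eq).
  - exact: minus_pq_1 S _ _ _ cfg eq.
  - exact: minus_p_q S _ _ _ cfg eq.
  - exact: minus_q_p S _ _ _ cfg eq.
(* For odd [v] the factors [u ^ 2 - N] and [u ^ 2 + N] are coprime with sum [2 u ^ 2], and all four
   half equations are insoluble. *)
have [ov|ev] := boolP (odd v).
  have oUN : odd (u ^ 2 + N) by rewrite oddD oddX pars.
  have cxy := coprime_sub_add (ltnW Nu) oUN cu2N.
  have oxy : odd ((u ^ 2 - N) * (u ^ 2 + N)).
    by rewrite exy oddM oddX (oddM p) od_p od_q ov.
  have [a [b [r [s [sp rE sE vE crs]]]]] :=
    pq_split_quartic pr_p pr_q v0 cxy exy.
  move: ov; rewrite vE oddM => /andP[od_r od_s].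
  have eq : 2 * u ^ 2 = a * r ^ 4 + b * s ^ 4.
    by rewrite -rE -sE; clear -Nu; lia.
  case: sp eq => eq.
  - exact: half_1_pq S _ _ _ crs od_r od_s eq.
  - exact: half_insolubleC (half_1_pq S) _ _ _ crs od_r od_s eq.
  - exact: half_p_q S _ _ _ crs od_r od_s eq.
  - exact: half_insolubleC (half_p_q S) _ _ _ crs od_r od_s eq.
have [w vE] : exists w, v = 2 * w by exists v./2; clear -ev; lia.
have od_u : odd u.
  rewrite -coprime2n coprime_sym; apply: coprime_dvd cuv => //.
  by rewrite vE dvdn_mulr.
have od_N : odd N by move: pars; rewrite od_u (negPf ev); case: (odd N).
have w0 : 0 < w by clear -vE v0; lia.
have od_u2 : odd (u ^ 2) by rewrite oddX.
pose x := (u ^ 2 - N)./2; pose y := (u ^ 2 + N)./2.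
have xE : u ^ 2 - N = 2 * x by rewrite /x; clear -od_u2 od_N; lia.
have yE : u ^ 2 + N = 2 * y by rewrite /y; clear -od_u2 od_N; lia.
have xyE : x * y = 4 * (p * q * w ^ 4).
  apply/eqP; rewrite -(eqn_pmul2l (isT : 0 < 4)); apply/eqP.
  have -> : 4 * (x * y) = (2 * x) * (2 * y) by rewrite mulnACA.
  rewrite -xE -yE exy vE expnMn.
  by move: (p * q) (w ^ 4) => n W; clear; lia.
have cxy : coprime x y.
  have gx := dvdn_gcdl x y; have gy := dvdn_gcdr x y.
  apply: (coprime_of_gcd_dvd cu2N).
    have -> : u ^ 2 = x + y by clear -xE yE Nu; lia.
    by rewrite dvdn_add.
  have -> : N = y - x by clear -xE yE Nu; lia.
  by rewrite dvdn_sub.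
(* The sum [x + y = u ^ 2] is odd, so exactly one of [x], [y] is even and it absorbs the whole
   factor 4: [X] is the odd one, [4 Y] the even one. *)
have [X [Y [cXY od_X XYE u2E]]] : exists X Y,
    [/\ coprime X Y, odd X, X * Y = p * q * w ^ 4 & u ^ 2 = X + 4 * Y].
  have aux X Z : coprime X Z -> X * Z = 4 * (p * q * w ^ 4) ->
      u ^ 2 = X + Z -> odd X -> exists X Y,
      [/\ coprime X Y, odd X, X * Y = p * q * w ^ 4 & u ^ 2 = X + 4 * Y].
    move=> cXZ XZE uE od_X.
    have /dvdnP[Y YE] : 4 %| Z.
      rewrite -(@Gauss_dvdr _ X); first by rewrite XZE dvdn_mulr.
      by rewrite (coprime_pexpl (k := 2) 2) // coprime2n.
    exists X, Y; split=> //.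
    - by apply: coprime_dvd cXZ; rewrite // YE dvdn_mulr.
    - apply/eqP; rewrite -(eqn_pmul2l (isT : 0 < 4)) -XZE YE.
      by rewrite mulnCA (mulnC Y).
    - by rewrite uE YE mulnC.
  have xyu : u ^ 2 = x + y by clear -xE yE Nu; lia.
  have [od_x|ev_x] := boolP (odd x); first exact: aux cxy xyE xyu od_x.
  apply: (aux y x); rewrite 1?coprime_sym 1?mulnC 1?addnC //.
  by move: od_u2; rewrite xyu oddD (negPf ev_x).
have [a [b [r [s [sp rE sE wE crs]]]]] :=
  pq_split_quartic pr_p pr_q w0 cXY XYE.
move: w0 od_X; rewrite wE muln_gt0 rE oddM oddX => /andP[r0 s0] /andP[_ od_r].
have eq : u ^ 2 = a * r ^ 4 + 4 * b * s ^ 4 by rewrite u2E rE sE mulnA.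
have [cur cus] : coprime u r /\ coprime u (2 * s).
  by split; apply: coprime_dvd cuv => //; rewrite vE wE;
    [rewrite mulnCA dvdn_mulr|rewrite mulnCA dvdn_mull].
have s_lt_v : s < v.
  by rewrite vE wE; clear -r0 s0; nia.
have r_lt_v : r < v.
  by rewrite vE wE; clear -r0 s0; nia.
case: sp eq {rE sE} => eq.
(* Case [d = 1]: the halves of [u - r ^ 2] and [u + r ^ 2] are coprime, differ by [r ^ 2] and have
   product [p q s ^ 4]. *)
- have ru : r ^ 2 < u.
    rewrite -ltn_sqr -expnM eq mul1n -[X in X < _]addn0 ltn_add2l.
    by rewrite muln_gt0 expn_gt0 s0 muln_gt0 n0.
  have od_r2 : odd (r ^ 2) by rewrite oddX.
  pose x' := (u - r ^ 2)./2; pose y' := (u + r ^ 2)./2.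
  have xE' : u - r ^ 2 = 2 * x' by rewrite /x'; clear -ru od_r2 od_u; lia.
  have yE' : u + r ^ 2 = 2 * y' by rewrite /y'; clear -od_r2 od_u; lia.
  apply: (@step x' y' s r); rewrite ?s0 //.
  + have gx := dvdn_gcdl x' y'; have gy := dvdn_gcdr x' y'.
    have c : coprime u (r ^ 2) by rewrite coprime_pexpr.
    apply: (coprime_of_gcd_dvd c).
      have -> : u = x' + y' by clear -xE' yE' ru; lia.
      by rewrite dvdn_add.
    have -> : r ^ 2 = y' - x' by clear -xE' yE' ru; lia.
    by rewrite dvdn_sub.
  + apply/eqP; rewrite -(eqn_pmul2l (isT : 0 < 4)); apply/eqP.
    have -> : 4 * (x' * y') = (2 * x') * (2 * y') by rewrite mulnACA.
    by rewrite -xE' -yE' -subn_sqr -expnM eq mul1n addKn !mulnA.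
  + by clear -xE' yE' ru; lia.
(* Case [d = n]: [u - 2 s ^ 2] and [u + 2 s ^ 2] are odd and coprime, differ by [(2 s) ^ 2] and have
   product [p q r ^ 4]. *)
- have su : 2 * s ^ 2 < u.
    rewrite -ltn_sqr expnMn -expnM eq muln1 -[X in X < _]add0n ltn_add2r.
    by rewrite muln_gt0 expn_gt0 r0 n0.
  apply: (@step (u - 2 * s ^ 2) (u + 2 * s ^ 2) r (2 * s)); rewrite ?r0 //.
  + apply: coprime_sub_add; [exact: ltnW|by rewrite oddD oddM od_u|].
    apply: (coprime_dvd (dvdnn u) _ (coprimeXr 2 cus)).
    by rewrite expnMn dvdn_mul.
  + by rewrite -subn_sqr expnMn -expnM eq muln1 addnK.
  + by rewrite expnMn; clear -su; lia.
- exact: plus_p_q S _ _ _ crs od_r eq.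
- exact: plus_q_p S _ _ _ crs od_r eq.
Qed.

(** * Local obstructions *)

Lemma square_mod16 (N : nat) : (N ^ 2) %% 16 \in [:: 0; 1; 4; 9].
Proof.
rewrite -modnXm; have : N %% 16 < 16 by rewrite ltn_pmod.
by move: (N %% 16); do 16! [case=> //].
Qed.

Lemma quartic_mod16 (u : nat) : (u ^ 4) %% 16 = odd u.
Proof.
have <- : odd (u %% 16) = odd u by rewrite odd_mod.
rewrite -modnXm; have : u %% 16 < 16 by rewrite ltn_pmod.
by move: (u %% 16); do 16! [case=> //].
Qed.

Lemma mul_quartic_mod16 (a u : nat) : exists k, a * u ^ 4 = 16 * k + odd u * a.
Proof.
exists (a * (u ^ 4 %/ 16)).
rewrite {1}(divn_eq (u ^ 4) 16) quartic_mod16.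
by move: (u ^ 4 %/ 16) (odd u : nat) => k o; clear; lia.
Qed.

Lemma coprime_odd (u v : nat) : coprime u v -> odd u || odd v.
Proof.
apply: contraTT; rewrite negb_or => /andP[eu ev].
have : 2 %| gcdn u v by rewrite dvdn_gcd !dvdn2 eu.
by rewrite /coprime; apply: contraTneq => ->.
Qed.

(** Fourth powers are 0 or 1 modulo 16, by parity. The three conditions treat [u] and [v] both odd,
    only [v] even, and only [u] even. *)
Lemma minus_insoluble_mod16 (a b : nat) :
  (forall c, c \in [:: 0; 1; 4; 9] ->
    [/\ (c + b) %% 16 <> a %% 16, c <> a %% 16 & (c + b) %% 16 <> 0]) ->
  minus_insoluble a b.
Proof.
move=> H N u v /coprime_odd odd_uv e; have [] := H _ (square_mod16 N).
have [k kE] := mul_quartic_mod16 a u; have [l lE] := mul_quartic_mod16 b v.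
move: (N ^ 2) e => N2; rewrite {}kE {}lE.
by case: (odd u) odd_uv; case: (odd v) => // _; rewrite !(mul0n, mul1n); lia.
Qed.

Lemma half_insoluble_mod16 (a b : nat) :
  (forall c, c \in [:: 0; 1; 4; 9] -> (2 * c) %% 16 <> (a + b) %% 16) ->
  half_insoluble a b.
Proof.
move=> H N r s _ od_r od_s e; have := H _ (square_mod16 N).
have [k kE] := mul_quartic_mod16 a r; have [l lE] := mul_quartic_mod16 b s.
by move: (N ^ 2) e => N2; rewrite {}kE {}lE od_r od_s !mul1n; lia.
Qed.

Lemma plus_insoluble_mod4 (a b : nat) : a %% 4 = 3 -> plus_insoluble a b.
Proof.
move=> a4 N r s _ od_r e; have := square_mod16 N.
have [k kE] := mul_quartic_mod16 a r.
rewrite kE od_r mul1n -mulnA in e.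
move: (N ^ 2) (b * s ^ 4) e => N2 t; rewrite !inE.
by clear -a4; lia.
Qed.

Lemma PoszX (n k : nat) : Posz (n ^ k) = (Posz n ^+ k)%R.
Proof. by rewrite -natz natrX natz. Qed.

Section OddObstructions.
Variables (q : nat).
Hypothesis pr_q : prime q.
Local Open Scope ring_scope.

(** Modulo [q] the equation reads [N ^ 2 = a u ^ 4], which would make [a] a square. The other
    obstructions at [q] follow the same pattern. *)
Lemma minus_insoluble_right (a : nat) : ~ sqmod q a -> minus_insoluble a q.
Proof.
move=> ns N u v cuv /(congr1 Posz).
rewrite PoszD (PoszM a) (PoszM q) !PoszX => e; apply: ns.
have q1 : ~~ (q %| (-1 : int))%Z.
  by rewrite dvdzE dvdn1; apply: contraTneq pr_q => /= ->.
apply: (sqmod_of_quartic (X := Posz N) (w := Posz u) (z := Posz v) pr_q cuv q1).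
by rewrite mulrN1 mulNr -e addrK.
Qed.

Lemma minus_insoluble_left (k b : nat) : ~~ (q %| k)%N -> ~ sqmod q (- b%:Z) ->
  minus_insoluble (q * k) b.
Proof.
move=> qk ns N u v cuv /(congr1 Posz).
rewrite PoszD (PoszM b) (PoszM (q * k)) (PoszM q) !PoszX => e; apply: ns.
have cvu : coprimez (Posz v) (Posz u) by rewrite coprimez_sym.
apply: (sqmod_of_quartic (X := Posz N) (k := Posz k) (z := Posz u) pr_q cvu qk).
by rewrite -e mulNr addrC addrK.
Qed.

Hypothesis od_q : odd q.

Lemma odd_prime_ndvd_pow2 n : (q %| 2 ^ n)%N = false.
Proof.
apply/negP; rewrite Euclid_dvdX // dvdn_prime2 // => /andP[/eqP q2 _].
by move: od_q; rewrite q2.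
Qed.

Lemma plus_insoluble_right (a : nat) : ~ sqmod q a -> plus_insoluble a q.
Proof.
move=> ns N r s crs _ /(congr1 Posz).
rewrite PoszD (PoszM a) (PoszM (4 * q)) (PoszM 4) !PoszX => e; apply: ns.
have q4 : ~~ (q %| (4 : int))%Z by rewrite dvdzE (odd_prime_ndvd_pow2 2).
apply: (sqmod_of_quartic (X := Posz N) (w := Posz r) (z := Posz s) pr_q crs q4).
by rewrite e (mulrC 4).
Qed.

Lemma plus_insoluble_left (b : nat) : ~ sqmod q b -> plus_insoluble q b.
Proof.
move=> ns N r s crs _ /(congr1 Posz).
rewrite PoszD (PoszM q) (PoszM (4 * b)) (PoszM 4) !PoszX => e; apply: ns.
have q4 : ~~ (q %| (4 : int))%Z by rewrite dvdzE (odd_prime_ndvd_pow2 2).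
have q1 : ~~ (q %| (1 : int))%Z.
  by rewrite dvdzE dvdn1; apply: contraTneq pr_q => /= ->.
apply: (sqmod_mulK pr_q q4); first by exists 2; rewrite subrr dvdz0.
have csr : coprimez (Posz s) (Posz r) by rewrite coprimez_sym.
apply: (sqmod_of_quartic (X := Posz N) (z := Posz r) pr_q csr q1).
by rewrite mulr1 addrC.
Qed.

(** Doubling the equation gives [(2 N) ^ 2 = 2 a r ^ 4] modulo [q]. *)
Lemma half_insoluble_right (a k : nat) : ~~ (q %| k)%N ->
  ~ sqmod q (2 * a%:Z) -> half_insoluble a (q * k).
Proof.
move=> qk ns N r s crs _ _ /(congr1 Posz).
rewrite PoszD (PoszM 2) (PoszM a) (PoszM (q * k)) (PoszM q) !PoszX => e.
have q2k : ~~ (q %| 2 * k%:Z)%Z.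
  by rewrite dvdzE abszM Euclid_dvdM // (odd_prime_ndvd_pow2 1).
apply: ns; apply: (sqmod_of_quartic (X := 2 * N%:Z) (w := Posz r) (z := Posz s)
  pr_q crs q2k).
have -> : (2 * N%:Z) ^+ 2 = 2 * (2 * N%:Z ^+ 2) by ring.
by rewrite e; ring.
Qed.

End OddObstructions.

(** * The four congruence conditions *)

Lemma square_mod16P (P : nat -> Prop) :
  P 0 -> P 1 -> P 4 -> P 9 -> forall c, c \in [:: 0; 1; 4; 9] -> P c.
Proof.
by move=> P0 P1 P4 P9 c; rewrite !inE => /or4P[] /eqP ->.
Qed.

Lemma neg_nonsquare_mod1 (q : nat) (t : int) : prime q -> q %% 4 = 1 ->
  ~ sqmod q t -> ~ sqmod q (- t).
Proof.
move=> pr_q q4 ns sq; apply: ns; apply: (sqmod_mulK (s := -1) pr_q).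
- by rewrite dvdzE dvdn1; apply: contraTneq pr_q => /= ->.
- exact: neg_one_square.
- by rewrite mulN1r.
Qed.

Lemma neg_nonsquare_mod3 (q : nat) (t : int) : prime q -> q %% 4 = 3 ->
  ~~ (q %| t)%Z -> sqmod q t -> ~ sqmod q (- t).
Proof.
move=> pr_q q4 nd sq; rewrite -mulrN1 => sqN.
exact: (neg_one_nonsquare pr_q q4) (sqmod_mulK pr_q nd sq sqN).
Qed.

Lemma two_mul_nonsquare_mod3 (q : nat) (t : int) : prime q -> q %% 8 = 3 ->
  ~~ (q %| t)%Z -> sqmod q t -> ~ sqmod q (2 * t).
Proof.
move=> pr_q q8 nd sq; rewrite mulrC => sq2.
by apply: (@two_nonsquare q); [left|exact: sqmod_mulK nd sq sq2].
Qed.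

(* Since [- t] is a square, [- 2] would be one along with [2 * t]. *)
Lemma two_mul_nonsquare_mod7 (q : nat) (t : int) : prime q -> q %% 8 = 7 ->
  ~~ (q %| t)%Z -> ~ sqmod q t -> ~ sqmod q (2 * t).
Proof.
move=> pr_q q8 nd ns sq2; apply: (@neg_two_nonsquare q); first by right.
have q4 : q %% 4 = 3 by lia.
apply: (@sqmod_mulK q (- t)) => //; first by rewrite dvdzE abszN -dvdzE.
  exact: sqmod_neg.
by rewrite mulrNN mulrC.
Qed.

Ltac mod16 := apply: square_mod16P; by [lia | split; lia].

Lemma selmer_trivial_i (p q : nat) : prime p -> prime q -> odd q ->
  p %% 4 = 1 -> q %% 4 = 1 -> p * q %% 16 = 13 ->
  ~ sqmod q p -> selmer_trivial p q.
Proof.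
move=> pr_p pr_q od_q p4 q4 pq16 ns.
have q1 := prime_gt1 pr_q.
(* As 16 divides [(p - 1) (q - 1)], [p + q] agrees with [p q + 1]. Doubled squares are 0, 2 or 8
   modulo 16, so 14 excludes both half equations. *)
have pq14 : (p + q) %% 16 = 14.
  have residues n : n %% 4 = 1 ->
      n %% 16 = 1 \/ n %% 16 = 5 \/ n %% 16 = 9 \/ n %% 16 = 13 by lia.
  move: pq16; rewrite -modnMm -modnDm.
  by case: (residues _ p4) => [->|[->|[->|->]]];
    case: (residues _ q4) => [->|[->|[->|->]]].
split.
- apply: minus_insoluble_mod16; mod16.
- exact: minus_insoluble_right.
- rewrite -[q]muln1; apply: minus_insoluble_left => //.
    by rewrite dvdn1; lia.
  exact: neg_nonsquare_mod1.
- exact: plus_insoluble_right.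
- exact: plus_insoluble_left.
- apply: half_insoluble_mod16; mod16.
- apply: half_insoluble_mod16; mod16.
Qed.

Lemma selmer_trivial_ii (p q : nat) : prime p -> prime q -> odd p -> odd q ->
  p %% 4 <> q %% 4 -> p * q %% 8 = 3 -> ~ sqmod q p -> selmer_trivial p q.
Proof.
move=> pr_p pr_q od_p od_q pq4 pq8 ns.
have q1 := prime_gt1 pr_q.
(* Here 8 divides [(p - 1) (q - 1)], so [p + q] is [p q + 1] modulo 8, while doubled squares are 0
   or 2. *)
have pq8' : (p + q) %% 8 = 4.
  have residues n : odd n ->
      n %% 8 = 1 \/ n %% 8 = 3 \/ n %% 8 = 5 \/ n %% 8 = 7 by lia.
  move: pq8 pq4; rewrite -modnMm -modnDm.
  rewrite -(@modn_dvdm 8 p 4) // -(@modn_dvdm 8 q 4) //.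
  by case: (residues _ od_p) => [->|[->|[->|->]]];
    case: (residues _ od_q) => [->|[->|[->|->]]].
split.
- apply: minus_insoluble_mod16; mod16.
- exact: minus_insoluble_right.
(* If [q] is 3 modulo 4, then [- p] is a square modulo [q]; the obstruction is instead that [q - p]
   is 2 modulo 8, and [q] and [- p] are 3 modulo 4. *)
- have [q4|q4] : q %% 4 = 1 \/ q %% 4 = 3 by lia.
    rewrite -[q]muln1; apply: minus_insoluble_left => //.
      by rewrite dvdn1; lia.
    exact: neg_nonsquare_mod1.
  apply: minus_insoluble_mod16; mod16.
- exact: plus_insoluble_right.
- exact: plus_insoluble_left.
- apply: half_insoluble_mod16; mod16.
- apply: half_insoluble_mod16; mod16.
Qed.

Lemma selmer_trivial_iii (p q : nat) : prime p -> prime q ->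
  p %% 4 = 3 -> q %% 8 = 3 ->
  p %% 16 = (q + 8) %% 16 \/ p %% 16 = (q + 12) %% 16 ->
  ~~ (q %| p) -> ~~ (p %| q) -> sqmod q p -> selmer_trivial p q.
Proof.
move=> pr_p pr_q p4 q8 pq16 ndqp ndpq sq.
have q1 := prime_gt1 pr_q.
have od_q : odd q by lia.
have q4 : q %% 4 = 3 by lia.
split.
- apply: minus_insoluble_left => //; exact: neg_one_nonsquare.
(* The values 8 and 12 of [p - q] are nonsquares modulo 16, as are [p] and [- q]. *)
- apply: minus_insoluble_mod16; mod16.
- rewrite -[q]muln1; apply: minus_insoluble_left => //.
    by rewrite dvdn1; lia.
  exact: neg_nonsquare_mod3.
- exact: plus_insoluble_mod4.
- exact: plus_insoluble_mod4.
- rewrite mulnC; apply: half_insoluble_right => //.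
  by apply: two_nonsquare; left.
- rewrite -[q]muln1; apply: half_insoluble_right => //.
    by rewrite dvdn1; lia.
  exact: two_mul_nonsquare_mod3.
Qed.

Lemma selmer_trivial_iv (p q : nat) : prime p -> prime q ->
  p %% 8 = 3 -> q %% 4 = 3 ->
  q %% 16 = (p + 8) %% 16 \/ q %% 16 = (p + 12) %% 16 ->
  ~~ (q %| p) -> ~~ (p %| q) -> ~ sqmod q p -> selmer_trivial p q.
Proof.
move=> pr_p pr_q p8 q4 pq16 ndqp ndpq ns.
have q1 := prime_gt1 pr_q.
have od_q : odd q by lia.
have od_p : odd p by lia.
have p4 : p %% 4 = 3 by lia.
split.
- apply: minus_insoluble_left => //; exact: neg_one_nonsquare.
- exact: minus_insoluble_right.
- apply: minus_insoluble_mod16; mod16.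
- exact: plus_insoluble_mod4.
- exact: plus_insoluble_mod4.
- apply: half_insoluble_right => //.
  by apply: two_nonsquare; left.
(* If [q - p] is 8, then [p + q] is 14 modulo 16, not a doubled square; if it is 12, then [q] is 7
   modulo 8 and [2 p] is a nonsquare modulo [q]. *)
- case: pq16 => pq16; first by apply: half_insoluble_mod16; mod16.
  rewrite -[q]muln1; apply: half_insoluble_right => //.
    by rewrite dvdn1; lia.
  by apply: two_mul_nonsquare_mod7 => //; lia.
Qed.

Local Open Scope ring_scope.

(** * Rational points *)

Lemma mul_square_gcd (A B C : nat) : (0 < A)%N -> (0 < B)%N ->
  (A * B = C ^ 2)%N -> exists M N : nat,
  [/\ A = gcdn A B * M ^ 2 & B = gcdn A B * N ^ 2]%N.
Proof.
move=> A0 B0 e; set g := gcdn A B.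
have g0 : (0 < g)%N by rewrite gcdn_gt0 A0.
have /dvdnP[A' AE] : (g %| A)%N by exact: dvdn_gcdl.
have /dvdnP[B' BE] : (g %| B)%N by exact: dvdn_gcdr.
have [A'0 B'0] : (0 < A')%N /\ (0 < B')%N.
  by split; [case: A' AE A0 | case: B' BE B0] => // ->.
have cAB : coprime A' B'.
  by rewrite /coprime -(eqn_pmul2r g0) muln_gcdl -AE -BE mul1n.
have e2 : (C ^ 2 = (A' * B') * g ^ 2)%N by rewrite -e AE BE mulnACA.
have /dvdnP[C' CE] : (g %| C)%N.
  by rewrite -(@dvdn_pexp2r _ _ 2) // e2 dvdn_mull.
have e3 : (A' * B' = C' ^ 2)%N.
  have g20 : (0 < g ^ 2)%N by rewrite expn_gt0 g0.
  by apply/eqP; rewrite -(eqn_pmul2r g20) -e2 CE expnMn.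
have [M [N [ME NE _ _]]] := coprime_mul_expn2 (isT : (0 < 2)%N) A'0 B'0 cAB e3.
by exists M, N; rewrite {1}AE {1}BE ME NE ![(_ * g)%N]mulnC.
Qed.

Lemma pq_splitM (p q a b : nat) : pq_split p q a b -> (a * b = p * q)%N.
Proof. by case; rewrite ?mul1n ?muln1 // mulnC. Qed.

Lemma dvdn_pq_split (p q g : nat) : prime p -> prime q -> (g %| p * q)%N ->
  exists h, pq_split p q g h.
Proof.
move=> pr_p pr_q gpq; have p0 := prime_gt0 pr_p.
have prime_div r d : prime r -> (d %| r)%N -> d = 1%N \/ d = r.
  by case/primeP => _ H /H /pred2P.
have [pg|npg] := boolP (p %| g)%N.
  case/dvdnP: pg gpq => g' ->; rewrite mulnC dvdn_pmul2l // => g'q.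
  case: (prime_div q g' pr_q g'q) => ->.
    by exists q; rewrite muln1; constructor.
  by exists 1%N; constructor.
rewrite Gauss_dvdr in gpq; last by rewrite coprime_sym prime_coprime.
case: (prime_div q g pr_q gpq) => ->; first by exists (p * q)%N; constructor.
by exists p; constructor.
Qed.

(* A rational point has the shape [(a / e ^ 2, c / e ^ 3)]. *)
Lemma rational_point_shape (n : nat) (x y : rat) :
  y ^+ 2 = x ^+ 3 - n%:R * x ->
  exists (a c : int) (e : nat),
  [/\ (0 < e)%N, coprime `|a| e, c ^+ 2 = a * (a ^+ 2 - n%:Z * e%:Z ^+ 4)
    & c = 0 -> y = 0].
Proof.
case/ratP: y => c d' cd; case/ratP: x => a b' ab eq.
pose b := b'.+1; pose d := d'.+1.
have eqz : c ^+ 2 * b%:Z ^+ 3 = d%:Z ^+ 2 * (a * (a ^+ 2 - n%:Z * b%:Z ^+ 2)).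
  have d0 : d%:~R != 0 :> rat by rewrite intr_eq0.
  have b0 : b%:~R != 0 :> rat by rewrite intr_eq0.
  apply: (@intr_inj rat).
  rewrite !(rmorphXn, rmorphB, rmorphM) /= -(pmulrn _ n).
  move: eq d0 b0; rewrite -/b -/d.
  move: (b%:~R : rat) (d%:~R : rat) (c%:~R : rat) (a%:~R : rat).
  move=> B D C A eq d0 b0.
  have -> : C ^+ 2 = (C / D) ^+ 2 * D ^+ 2 by field.
  by rewrite eq; field; rewrite b0.
(* In lowest terms each side divides the other; then [b] divides [d], and the quotient [e] satisfies
   [b = e ^ 2]. *)
have db : (d ^ 2 = b ^ 3)%N.
  apply/eqP; rewrite eqn_dvd; apply/andP; split.
    have : (d%:Z ^+ 2 %| c ^+ 2 * b%:Z ^+ 3)%Z by rewrite eqz dvdz_mulr.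
    rewrite Gauss_dvdzr; last first.
      by rewrite coprimezXl // coprimezXr // coprimez_sym.
    by rewrite dvdzE !abszX.
  have : (b%:Z ^+ 3 %| d%:Z ^+ 2 * (a * (a ^+ 2 - n%:Z * b%:Z ^+ 2)))%Z.
    by rewrite -eqz dvdz_mull.
  rewrite Gauss_dvdzl; first by rewrite dvdzE !abszX.
  have cba : coprimez b%:Z a by rewrite coprimez_sym coprimezE.
  rewrite coprimezXl // coprimezMr cba /=.
  have /coprimezP[[u v] /= uv] : coprimez (a ^+ 2) b%:Z.
    by rewrite coprimezXl // coprimezE.
  rewrite coprimez_sym; apply/coprimezP.
  by exists (u, v + u * n%:Z * b%:Z); rewrite /= -uv; ring.
have /dvdnP[e dE] : (b %| d)%N.
  by rewrite -(@dvdn_pexp2r _ _ 2) // db (expnD _ 2 1) dvdn_mulr.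
have bE : b = (e ^ 2)%N.
  have b20 : (0 < b ^ 2)%N by rewrite expn_gt0.
  by apply/eqP; rewrite -(eqn_pmul2r b20) -expnMn -dE db expnS.
exists a, c, e; split.
- by case: e bE {dE}.
- by move: ab; rewrite -/b bE coprime_pexpr.
- have b30 : b%:Z ^+ 3 != 0 by rewrite expf_neq0.
  apply: (mulfI b30); rewrite mulrC eqz -PoszX -PoszX db bE PoszX.
  by rewrite -expnM PoszX.
- by move=> ->; rewrite mul0r.
Qed.

(** If [c] is nonzero, [A B] is a nonzero square. The gcd [g] of [A] and [B] divides [n e ^ 4] and
    is coprime to [e], so [g] divides [n]; dividing by [g] leaves a minus equation. *)
Lemma rational_point_trivial (p q : nat) : prime p -> prime q ->
  odd p -> odd q -> p <> q -> selmer_trivial p q ->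
  forall x y : rat, y ^+ 2 = x ^+ 3 - (p * q)%:R * x -> y = 0.
Proof.
move=> pr_p pr_q od_p od_q pq S x y.
case/rational_point_shape => a [c [e [e0 cae eq]]]; apply.
apply/eqP/negPn/negP => c0.
have D := quartic_descent pr_p pr_q od_p od_q pq S.
set n := (p * q)%N in eq D.
pose A := `|a|%N; pose t := a ^+ 2 - n%:Z * e%:Z ^+ 4; pose B := `|t|%N.
have AB : (A * B = `|c| ^ 2)%N by rewrite -abszM -abszX eq.
have : a * t != 0 by rewrite -eq expf_neq0.
rewrite mulf_eq0 negb_or -!absz_gt0 -/A -/B => /andP[A0 B0].
have [M [N [AE BE]]] := mul_square_gcd A0 B0 AB.
set g := gcdn A B in AE BE.
have at0 : 0 < a * t by rewrite -eq exprn_even_gt0.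
have AA : A%:Z ^+ 2 = a ^+ 2 by rewrite abszE real_normK ?num_real.
have g0 : (0 < g)%N by rewrite gcdn_gt0 A0.
have cMe : coprime M e.
  by apply: coprime_dvd cae => //; rewrite -/A AE (expnS M 1) mulnCA dvdn_mulr.
have cge : coprime g e by apply: coprime_dvd cae; rewrite ?dvdn_gcdl.
have M0 : (0 < M)%N by case: M AE A0 {cMe} => // ->; rewrite muln0.
(* The product [a t = c ^ 2] is positive, so [a] and [t] share their sign. The negative sign
   exchanges [M] with [e] and [g] with [h] in what follows. *)
have tri : (B + n * e ^ 4 = A ^ 2 \/ A ^ 2 + B = n * e ^ 4)%N.
  have BE' : B%:Z = `|t| by rewrite abszE.
  have [[a_gt t_gt]|[a_lt t_lt]] : 0 < a /\ 0 < t \/ a < 0 /\ t < 0.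
  - have [a_lt|a_gt|a_eq] := ltgtP a 0; last by rewrite a_eq mul0r in at0.
      by right; rewrite -(nmulr_rgt0 _ a_lt).
    by left; rewrite -(pmulr_rgt0 _ a_gt).
  - left; apply/eqP; rewrite -eqz_nat PoszD (PoszM n) !PoszX AA BE'.
    by rewrite gtr0_norm // subrK.
  right; apply/eqP; rewrite -eqz_nat PoszD (PoszM n) !PoszX AA BE'.
  by rewrite ltr0_norm // opprB addrC subrK.
have gn : (g %| n)%N.
  have gA2 : (g %| A ^ 2)%N by rewrite (expnS A 1) dvdn_mulr ?dvdn_gcdl.
  have gB : (g %| B)%N by exact: dvdn_gcdr.
  rewrite -(@Gauss_dvdl _ _ (e ^ 4)); last by rewrite coprime_pexpr.
  case: tri => tri; last by rewrite -tri dvdn_add.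
  by rewrite -(dvdn_addr _ gB) tri.
have [h gh] := dvdn_pq_split pr_p pr_q gn.
have nE : n = (g * h)%N by rewrite (pq_splitM gh).
have A2E : (A ^ 2 = g * (g * M ^ 4))%N.
  by rewrite AE expnMn -expnM mulnA.
have [{tri}eqM|{tri}eqM] : (N ^ 2 + h * e ^ 4 = g * M ^ 4 \/
    N ^ 2 + g * M ^ 4 = h * e ^ 4)%N.
- case: tri => tri; [left|right]; apply/eqP; rewrite -(eqn_pmul2l g0).
    by rewrite mulnDr -BE mulnA -nE tri A2E.
  by rewrite mulnDr -BE -A2E addnC tri nE mulnA.
- case: gh eqM => eqM.
  + by apply: (D e N M e0 cMe); rewrite /n eqM mul1n.
  + exact: minus_pq_1 S _ _ _ cMe eqM.
  + exact: minus_p_q S _ _ _ cMe eqM.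
  + exact: minus_q_p S _ _ _ cMe eqM.
rewrite coprime_sym in cMe.
case: gh eqM => eqM.
- exact: minus_pq_1 S _ _ _ cMe eqM.
- by apply: (D M N e M0 cMe); rewrite /n eqM mul1n.
- exact: minus_q_p S _ _ _ cMe eqM.
- exact: minus_p_q S _ _ _ cMe eqM.
Qed.

(** * Points over Q(i) *)

(** The addition formulas are rational in the coordinates and [ellA E], and [f] is injective, so it
    respects the case distinctions. *)
Lemma ell_add_morph (K : fieldType) (E : ellCurve K) (f : {rmorphism K -> K}) :
  f (ellA E) = ellA E ->
  let F P := if P is Some (x, y) then Some (f x, f y) else None in
  forall P Q, ell_add E (F P) (F Q) = F (ell_add E P Q).
Proof.
move=> fA F [[x1 y1]|] [[x2 y2]|] //=.
rewrite -rmorphN !(inj_eq (fmorph_inj f)); case: ifP => // _ /=.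
have -> : ell_slope E (f x1) (f y1) (f x2) (f y2) = f (ell_slope E x1 y1 x2 y2).
  rewrite /ell_slope (inj_eq (fmorph_inj f)); case: ifP => _.
    by rewrite fmorph_div rmorphD rmorphM rmorphXn rmorphM !rmorph_nat fA.
  by rewrite fmorph_div !rmorphB.
by rewrite !(rmorphB, rmorphXn, rmorphM).
Qed.

Definition conjQi (z : Qi) : Qi := conjc z.

Fact conjQi_additive : {morph conjQi : x y / x - y}.
Proof. by move=> [a b] [c d]; apply/eqP; rewrite eq_complex /= opprD !eqxx. Qed.

Fact conjQi_multiplicative : multiplicative conjQi.
Proof.
split=> [[a b] [c d]|]; last by apply/eqP; rewrite eq_complex /= oppr0 !eqxx.
by apply/eqP; rewrite eq_complex /= !(mulrN, mulNr) opprK opprD !eqxx.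
Qed.

HB.instance Definition _ :=
  GRing.isAdditive.Build Qi Qi conjQi conjQi_additive.
HB.instance Definition _ :=
  GRing.isMultiplicative.Build Qi Qi conjQi conjQi_multiplicative.

Section RationalReduction.
Variables (p q : nat) (pr_p : prime p) (pr_q : prime q).
Local Notation E := (E_pq pr_p pr_q).

Definition conj_coord (P : option (Qi * Qi)) : option (Qi * Qi) :=
  if P is Some (x, y) then Some (conjQi x, conjQi y) else None.

Lemma conj_ellA : conjQi (ellA E) = ellA E.
Proof. by rewrite /= rmorphN rmorph_nat. Qed.

Lemma on_conj_coord P : on_curve E P -> on_curve E (conj_coord P).
Proof.
case: P => [[x y]|] //= /eqP e; rewrite addr0 in e.
by rewrite addr0 -rmorphXn e rmorphD rmorphXn rmorphM rmorphN rmorph_nat.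
Qed.

Definition conj_point (P : point E) : point E :=
  Point (on_conj_coord (valP P)).

Lemma conj_pointD P Q : conj_point (P + Q) = conj_point P + conj_point Q.
Proof. by apply/val_inj/esym/(ell_add_morph conj_ellA). Qed.

Lemma conj_pointN P : conj_point (- P) = - conj_point P.
Proof.
by apply: val_inj => /=; case: (val P) => [[x y]|] //=; rewrite rmorphN.
Qed.

Lemma conj_pointK : involutive conj_point.
Proof.
move=> P; apply: val_inj => /=; case: (val P) => [[[a b] [c d]]|] //=.
by rewrite /conjQi /= !opprK.
Qed.

Hypothesis trivial_Q :
  forall x y : rat, y ^+ 2 = x ^+ 3 - (p * q)%:R * x -> y = 0.

Lemma opp_rat_eq (b : rat) : - b = b -> b = 0.
Proof. by move=> /eqP; rewrite eqNr => /eqP. Qed.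

Lemma real_natr (n : nat) : n%:R = Complex n%:R 0 :> Qi.
Proof. by rewrite -(rmorph_nat (real_complex rat)). Qed.

Lemma point_double0 (P : point E) :
  (forall x y, val P = Some (x, y) -> y = 0) -> P + P = 0.
Proof.
move=> H; apply: val_inj; rewrite -[LHS]/(ell_add E (val P) (val P)).
case: (val P) H => [[x y]|] //= H.
by rewrite (H x y erefl) oppr0 !eqxx.
Qed.

Lemma conj_fixed_torsion (P : point E) : conj_point P = P -> P + P = 0.
Proof.
move=> /(congr1 val) e; apply: point_double0 => -[a b] [c d] PE.
have := valP P; move: e.
rewrite /= PE /= => -[/opp_rat_eq -> /opp_rat_eq ->] /eqP.
move=> /(congr1 (@complex.Re rat)); rewrite real_natr /= => eq.
rewrite (trivial_Q (x := a) (y := c)) //; move: eq.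
by rewrite !expr2 /= => eq; ring: eq.
Qed.

(* Twisting by [(x, y) |-> (- x, i y)] turns [P] into a rational point. *)
Lemma conj_anti_torsion (P : point E) : conj_point P = - P -> P + P = 0.
Proof.
move=> /(congr1 val) e; apply: point_double0 => -[a b] [c d] PE.
have := valP P; move: e; rewrite /= PE /= => -[/opp_rat_eq -> cN] /eqP.
have {cN} -> : c = 0 by apply: opp_rat_eq; rewrite -cN.
move=> /(congr1 (@complex.Re rat)); rewrite real_natr /= => eq.
rewrite (trivial_Q (x := - a) (y := d)) //; apply: oppr_inj; move: eq.
by rewrite !expr2 /= => eq; ring: eq.
Qed.

(** Doubling kills both the sum and the difference of [P] and its conjugate, and these two doubles
    add up to [P *+ 4]. *)
Lemma point_4torsion (P : point E) : P *+ 4 = 0.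
Proof.
have fx : conj_point (P + conj_point P) = P + conj_point P.
  by rewrite conj_pointD conj_pointK addrC.
have ax : conj_point (P - conj_point P) = - (P - conj_point P).
  by rewrite conj_pointD conj_pointN conj_pointK opprB addrC.
have := conj_anti_torsion ax; rewrite -mulr2n => e1.
have := conj_fixed_torsion fx; rewrite -mulr2n => e2.
by rewrite -[RHS]addr0 -{1}e1 -e2 -mulrnDl addrACA addNr addr0 -mulr2n -mulrnA.
Qed.

Lemma has_rank0 : has_rank (point E) 0.
Proof.
split=> [|[|n] v H] //; first by exists (fun=> 0) => c _ [].
suff : (4 : int) = 0 by [].
(* Coefficients all equal to 4 give a nontrivial relation in any nonempty family. *)
apply: (H (fun=> 4) _ ord0); rewrite big1 // => i _.
exact: point_4torsion.
Qed.

End RationalReduction.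

Theorem corollary1p5 (p q : nat) (pr_p : prime p) (pr_q : prime q)
    (odd_p : odd p) (odd_q : odd q) (p_neq_q : p <> q) :
  [\/ [/\ (p = 1 %[mod 4])%N, (q = 1 %[mod 4])%N, (p * q = 13 %[mod 16])%N
        & legendre p q = -1],
      [/\ (p <> q %[mod 4])%N, (p * q = 3 %[mod 8])%N & legendre p q = -1],
      [/\ (p = 3 %[mod 4])%N, (q = 3 %[mod 4])%N, legendre p q = 1,
          (q = 3 %[mod 8])%N
        & (p%:Z - q%:Z = 8 %[mod 16])%Z \/ (p%:Z - q%:Z = 12 %[mod 16])%Z]
    | [/\ (p = 3 %[mod 4])%N, (q = 3 %[mod 4])%N, legendre p q = -1,
          (p = 3 %[mod 8])%N
        & (q%:Z - p%:Z = 8 %[mod 16])%Z \/ (q%:Z - p%:Z = 12 %[mod 16])%Z]] ->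
  has_rank (point (E_pq pr_p pr_q)) 0.
Proof.
move=> H; apply: has_rank0.
apply: (rational_point_trivial pr_p pr_q odd_p odd_q p_neq_q).
have q0 := prime_gt0 pr_q.
have npq : ~~ (p %| q)%N by rewrite dvdn_prime2 //; apply/eqP.
have nqp : ~~ (q %| p)%N by rewrite dvdn_prime2 // eq_sym; apply/eqP.
have shift (a b : nat) : (a%:Z - b%:Z = 8 %[mod 16])%Z \/
    (a%:Z - b%:Z = 12 %[mod 16])%Z ->
    (a %% 16 = (b + 8) %% 16 \/ a %% 16 = (b + 12) %% 16)%N.
  by clear; lia.
case: H => [[p4 q4 pq16 /(legendreN1 q0)]|[pq4 pq8 /(legendreN1 q0)]
  |[p4 q4 /legendre1[_ sq] q8 /shift d]
  |[p4 q4 /(legendreN1 q0) ns p8 /shift d]].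
- exact: selmer_trivial_i.
- exact: selmer_trivial_ii.
- exact: selmer_trivial_iii.
- exact: selmer_trivial_iv.
Qed.
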